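(* Let $\mathsf{S}_5=\langle q_1,\ldots,q_5\rangle$ be a symmetric numerical semigroup of embedding dimension $5$ that is not a complete intersection, with first Betti number $\beta$. Let $a>1$ be an integer and let $d_6\in\mathsf{S}_5\setminus\{q_1,\ldots,q_5\}$ with $\gcd(a,d_6)=1$. Let $\mathsf{W}_6=\langle aq_1,\ldots,aq_5,d_6\rangle$ be the resulting symmetric (not complete intersection) numerical semigroup. Then the Frobenius number of $\mathsf{W}_6$ has the lower bound $$F(\mathsf{W}_6)\ \ge\ F_{6w}=g_{6w}-\Big(a\sum_{j=1}^5 q_j+d_6\Big),$$ where $$g_{6w}=a\left(\lambda_5\sqrt[4]{\pi_5(q)}+d_6\right),\qquad \pi_5(q)=\prod_{j=1}^5 q_j,\qquad \lambda_5=\sqrt[4]{\frac{192(\beta-1)}{\beta}}.$$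
   Context: A numerical semigroup $\mathsf{S}=\langle d_1,\ldots,d_m\rangle$ is the additive submonoid of $\mathbb{Z}_{\ge 0}$ generated by positive integers $d_1,\ldots,d_m$ with $\gcd(d_1,\ldots,d_m)=1$; its embedding dimension is the number of elements of its minimal generating set, and when we write $\mathsf{S}_m=\langle d_1,\ldots,d_m\rangle$ with embedding dimension $m$ the $d_i$ are the minimal generators. $F(\mathsf{S})$ denotes the Frobenius number, the largest integer not in $\mathsf{S}$. $\mathsf{S}$ is symmetric if for every integer $n$ exactly one of $n$, $F(\mathsf{S})-n$ lies in $\mathsf{S}$. For a field $k$, the first Betti number $\beta_1$ of $\mathsf{S}$ is the minimal number of generators of the kernel of $k[z_1,\ldots,z_m]\to k[t]$, $z_i\mapsto t^{d_i}$ ($d_i$ the minimal generators). $\mathsf{S}$ is a complete intersection (CI) if $\beta_1=m-1$. *)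

(* Defs.v *)
From mathcomp Require Import all_boot all_order all_algebra.
From mathcomp Require Import boolp classical_sets.
From mathcomp Require Import mpoly.

Set Implicit Arguments.
Unset Strict Implicit.
Unset Printing Implicit Defensive.

Import Order.TTheory GRing.Theory Num.Theory.
Local Open Scope classical_set_scope.
Local Open Scope ring_scope.

Definition semigroup_of (s : seq nat) : set nat :=
  [set n | exists c : nat -> nat, n = (\sum_(x <- s) c x * x)%N].

Definition numerical_generators (s : seq nat) : Prop :=
  all (leq 1) s /\ (\big[gcdn/0]_(x <- s) x = 1)%N.

(* The elements of [s] are the minimal generators of the semigroup, without
   repetition, so that the embedding dimension is [size s]. *)
Definition minimal_generators (s : seq nat) : Prop :=
  uniq s /\
  forall t : seq nat, {subset t <= s} ->
    semigroup_of t = semigroup_of s -> {subset s <= t}.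

Definition int_mem (S : set nat) (z : int) : Prop :=
  exists2 n : nat, S n & z = n%:Z.

Definition is_frobenius (S : set nat) (F : int) : Prop :=
  ~ int_mem S F /\ forall z : int, F < z -> int_mem S z.

(* The Frobenius number is integer-valued: it is -1 for [S = setT]. The default
   value 0 is only taken when [~` S] is infinite. *)
Definition frobenius (S : set nat) : int := xget 0 [set F | is_frobenius S F].

Definition symmetric_semigroup (S : set nat) : Prop :=
  forall n : int,
    (int_mem S n /\ ~ int_mem S (frobenius S - n)) \/
    (~ int_mem S n /\ int_mem S (frobenius S - n)).

(* k[z_1, ..., z_m] -> k[t], z_i |-> t ^ d_i *)
Definition monomial_map (k : fieldType) (m : nat) (d : m.-tuple nat) :
    {mpoly k[m]} -> {poly k} :=
  mmap (@polyC k) (fun i : 'I_m => 'X^(tnth d i)).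

Definition defining_ideal (k : fieldType) (m : nat) (d : m.-tuple nat) :
    set {mpoly k[m]} :=
  [set p | monomial_map d p = 0].

Definition ideal_of (A : comNzRingType) (r : nat) (g : 'I_r -> A) : set A :=
  [set p | exists c : 'I_r -> A, p = \sum_(i < r) c i * g i].

(* [b] is the minimal number of generators of the defining ideal; [d] is meant
   to list the minimal generators of the semigroup. *)
Definition is_betti1 (k : fieldType) (m : nat) (d : m.-tuple nat) (b : nat) :
    Prop :=
  (exists g : 'I_b -> {mpoly k[m]}, ideal_of g = defining_ideal d) /\
  forall (r : nat) (g : 'I_r -> {mpoly k[m]}),
    ideal_of g = defining_ideal d -> (b <= r)%N.

Definition complete_intersection (k : fieldType) (m : nat) (d : m.-tuple nat) :
    Prop :=
  is_betti1 k d m.-1.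

(* Main.v *)
Require Import Defs.
From mathcomp Require Import all_boot all_order all_algebra.
From mathcomp Require Import zify ring lra.
From mathcomp Require Import boolp classical_sets reals exp.

Import Order.TTheory GRing.Theory Num.Theory.
Local Open Scope ring_scope.

(** Since (beta - 1) / beta <= 1, the bound follows from the sharper inequality
    192 q_1 ... q_5 <= g ^ 4 with g = F(S_5) + q_1 + ... + q_5, in which no
    syzygies occur, together with F(W_6) = a F(S_5) + (a - 1) d_6
    ([gluing_frobenius]).

    The inequality is a volume comparison. Let m = q_1, n = 4, and let L(y) =
    q_2 y_1 + ... + q_5 y_4 on R^4. Each residue class modulo m has a least
    element in S_5 (its Apery element), and this element is L(c) for some c in
    N^4, because removing a copy of m from a representation would leave a
    smaller element of the class. This gives m points of N^4; the unit cubes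
    with lower corners at these points have total volume m and lie in the
    simplex y >= 0, L(y) <= g. Comparing volumes would only give 24 q_1 ... q_5
    <= g ^ 4. Symmetry of S_5 says that w |-> F + m - w permutes the Apery
    elements; combined with the central symmetry of the cubes it shows that L is
    distributed symmetrically about g / 2 on their union. Hence half of the
    volume, m / 2, lies in the simplex L(y) <= g / 2, whose volume is (g / 2) ^
    4 / (24 q_2 q_3 q_4 q_5), and this is the inequality wanted. The same
    argument with n + 1 generators gives 2 ^ n n! q_1 ... q_(n+1) <= 2 g ^ n
    ([symmetric_semigroup_bound]).

    Volumes are replaced by counting: every unit cube is cut into N ^ n cells,
    the lattice points of a simplex are bounded by its volume after enlarging it
    by one cell in each direction ([simplex_points]), and N tends to infinity
    ([expn_limit]). *)

(** * Lattice points in a simplex *)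

Section Counting.
Local Open Scope nat_scope.

Lemma expnD_ge (x d n : nat) :
  x ^ n.+1 + n.+1 * d * x ^ n <= (x + d) ^ n.+1.
Proof.
elim: n => [|n IH]; first by rewrite !expn1 expn0; lia.
rewrite (expnS (x + d)) (expnS x n.+1).
apply: leq_trans (leq_mul (leqnn (x + d)) IH).
rewrite (expnS x n); set y := x ^ n; nia.
Qed.

(** A lower Riemann sum, with mesh d, of the integral of (n + 1) x ^ n between u
    and u + K d. *)
Lemma sum_expn_le (u d n K : nat) :
  \sum_(k < K) n.+1 * d * (u + k * d) ^ n <= (u + K * d) ^ n.+1.
Proof.
elim: K => [|K IH]; first by rewrite big_ord0.
rewrite big_ord_recr /= (mulSn K) (addnC d) addnA.
by apply: leq_trans (expnD_ge (u + K * d) d n); rewrite leq_add2r.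
Qed.

(** The unit cubes based at the points of Z are disjoint and lie in the simplex
    with sum of the y_i d_i at most T plus the sum of the d_i; the bound is the
    volume of that simplex.  The induction slices along the first coordinate. *)
Lemma simplex_points (n : nat) (d : 'I_n -> nat) (T : nat)
    (Z : seq {ffun 'I_n -> nat}) :
  (forall i, 0 < d i) -> uniq Z ->
  (forall z, z \in Z -> \sum_i z i * d i <= T) ->
  size Z * (n`! * \prod_i d i) <= (T + \sum_i d i) ^ n.
Proof.
elim: n d T Z => [|n IH] d T Z d_gt0 uZ leZ.
  rewrite big_ord0 fact0 !muln1 expn0.
  apply: (@uniq_leq_size _ Z [:: [ffun=> 0]] uZ) => z _.
  by rewrite inE; apply/eqP/ffunP => -[].
set d0 := d ord0; set d' := fun i => d (lift ord0 i).
set D := \sum_i d' i; set P := \prod_i d' i.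
have d0_gt0 : 0 < d0 by exact: d_gt0.
rewrite !big_ord_recl -/d0 -/D -/P.
set K := T %/ d0.
have leZ0 z : z \in Z -> z ord0 * d0 + \sum_i z (lift ord0 i) * d' i <= T.
  by move/leZ; rewrite big_ord_recl.
have ltK z : z \in Z -> z ord0 < K.+1.
  move=> /leZ0 h; rewrite ltnS leq_divRL //.
  by apply: leq_trans h; exact: leq_addr.
have slice (k : 'I_K.+1) :
    count (fun z : {ffun 'I_n.+1 -> nat} => z ord0 == k) Z * (n`! * P)
      <= (T - k * d0 + D) ^ n.
  pose beh (z : {ffun 'I_n.+1 -> nat}) := [ffun i => z (lift ord0 i)].
  rewrite -size_filter; set Zk := filter _ _.
  rewrite -(size_map beh Zk); apply: IH; first by move=> i; exact: d_gt0.
    rewrite map_inj_in_uniq ?filter_uniq // => y z.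
    rewrite !mem_filter => /andP[/eqP yk _] /andP[/eqP zk _] /ffunP eyz.
    apply/ffunP => i; case: (unliftP ord0 i) => [j ->|->]; last by rewrite yk zk.
    by have := eyz j; rewrite !ffunE.
  move=> _ /mapP[z + ->]; rewrite mem_filter => /andP[/eqP zk /leZ0].
  rewrite zk => le_z; under eq_bigr => i _ do rewrite ffunE.
  rewrite leq_subRL; last by apply: leq_trans le_z; exact: leq_addr.
  exact: le_z.
have -> : size Z = \sum_(k < K.+1)
    count (fun z : {ffun 'I_n.+1 -> nat} => z ord0 == k) Z.
  elim: Z {uZ leZ leZ0 slice} ltK => [|z Z IHZ] ltK.
    by rewrite big1.
  rewrite /= IHZ; last by move=> y yZ; apply: ltK; rewrite inE yZ orbT.
  rewrite big_split /= -add1n; congr (_ + _).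
  have zK := ltK z (mem_head _ _).
  rewrite (bigD1 (Ordinal zK)) //= eqxx big1 // => i /eqP iz.
  by case: eqP => // e; case: iz; apply/val_inj.
rewrite big_distrl /= factS.
pose u := T %% d0 + D.
apply: leq_trans (_ : \sum_(k < K.+1) n.+1 * d0 * (u + k * d0) ^ n <= _).
  (* Reversing the order of the slices makes their heights the increasing
     progression u + k d0 that [sum_expn_le] sums. *)
  rewrite [X in _ <= X](reindex_inj rev_ord_inj) /=; apply: leq_sum => k _.
  have -> : u + (K.+1 - k.+1) * d0 = T - k * d0 + D.
    have := divn_eq T d0; rewrite -/K /u => eT; rewrite subSS mulnBl.
    have : k * d0 <= K * d0 by rewrite leq_mul2r -ltnS ltn_ord orbT.
    lia.
  apply: leq_trans (leq_mul (leqnn (n.+1 * d0)) (slice k)).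
  by set c := count _ _; rewrite !mulnA; lia.
apply: leq_trans (sum_expn_le _ _ _ _) _.
have -> // : u + K.+1 * d0 = T + (d0 + D).
by have := divn_eq T d0; rewrite -/K /u mulSn; lia.
Qed.

(** [tau] sends the points where [L] exceeds T / 2 injectively to points where
    it does not. *)
Lemma half_card (I : finType) (L : I -> nat) (tau : I -> I) (T : nat) :
  injective tau -> (forall i, L i + L (tau i) = T) ->
  #|I| <= 2 * #|[pred i | L i <= T %/ 2]|.
Proof.
move=> tau_inj LT; rewrite -(cardC [pred i | L i <= T %/ 2]) mul2n -addnn.
rewrite leq_add2l -(card_image tau_inj); apply: subset_leq_card.
apply/fintype.subsetP => _ /fintype.imageP[i + ->].
by rewrite !inE -ltnNge; have := LT i; lia.
Qed.

(** (N G + C) ^ n = (N G) ^ n + O(N ^ (n - 1)), multiplied by N to avoid a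
    negative exponent when n = 0. *)
Lemma expn_asymp (n G C : nat) :
  exists K, forall N, 0 < N -> N * (N * G + C) ^ n <= N ^ n * (N * G ^ n + K).
Proof.
elim: n => [|n [K IH]]; first by exists 0 => N _; rewrite !expn0; lia.
exists (G ^ n * C + K * (G + C)) => N N_gt0.
rewrite expnSr mulnA.
apply: leq_trans (leq_mul (IH N N_gt0) (leqnn (N * G + C))) _.
rewrite (expnSr N) -!mulnA leq_mul2l; apply/orP; right.
rewrite expnSr; set g := G ^ n.
have : K * C <= N * (K * C) by rewrite leq_pmull.
nia.
Qed.

(** Dividing the hypothesis by N ^ n and letting N tend to infinity; with values
    in nat it is enough to take N larger than the constant of [expn_asymp]. *)
Lemma expn_limit (n A B G C : nat) :
  (forall N, 0 < N -> A * N ^ n <= B * (N * G + C) ^ n) -> A <= B * G ^ n.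
Proof.
move=> leN; have [K leK] := expn_asymp n G C.
rewrite leqNgt; apply/negP => ltA.
pose N := (B * K).+1.
have h1 := leq_mul (leqnn N) (leN N isT).
have h2 := leq_mul (leqnn B) (leK N isT).
have Nn_gt0 : 0 < N ^ n by rewrite expn_gt0.
have : N ^ n * (N * A) <= N ^ n * (B * (N * G ^ n + K)).
  have -> : N ^ n * (N * A) = N * (A * N ^ n) by rewrite mulnC -!mulnA.
  by apply: leq_trans h1 _; rewrite mulnCA (mulnCA (N ^ n)).
rewrite leq_pmul2l // => h3.
have := leq_mul (leqnn N) ltA.
have : B * (N * G ^ n + K) < N * (B * G ^ n).+1.
  by rewrite mulnDr mulnS mulnCA addnC ltn_add2r.
by move=> h4 h5; have := leq_trans h4 (leq_trans h5 h3); rewrite ltnn.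
Qed.

(** * Comparing half of a symmetric staircase with a simplex *)

(** Volumes up to half of the maximal height are compared, for m unit cubes whose lower corners [c j] are
    paired by [sigma] so that the values of the linear form on paired corners
    add up to a constant E.  The cell r of the cube at c is paired with the
    opposite cell of the cube at the partner of c. *)
Lemma symmetric_staircase (n m E : nat) (d : 'I_n -> nat)
    (c : 'I_m -> 'I_n -> nat) (sigma : 'I_m -> 'I_m) :
  (forall i, 0 < d i) ->
  injective (fun j => \sum_i c j i * d i) ->
  injective sigma ->
  (forall j, \sum_i c j i * d i + \sum_i c (sigma j) i * d i = E) ->
  2 ^ n * n`! * (m * \prod_i d i) <= 2 * (E + \sum_i d i) ^ n.
Proof.
move=> d_gt0 c_inj sigma_inj cE.
set D := \sum_i d i; set P := \prod_i d i.
(* The 2 D comes from enlarging the simplex of size T / 2 by one cell and then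
   doubling. *)
apply: (@expn_limit n _ _ _ (2 * D)) => -[//|N] _.
pose I := ('I_m * {ffun 'I_n -> 'I_N.+1})%type.
pose z (t : I) : {ffun 'I_n -> nat} := [ffun i => c t.1 i * N.+1 + t.2 i].
pose L (t : I) := \sum_i z t i * d i.
pose tau (t : I) : I := (sigma t.1, [ffun i => rev_ord (t.2 i)]).
pose T := N.+1 * E + N * D.
have z_inj : injective z.
  move=> [j r] [j' r'] /ffunP ezz.
  have e1 i : c j i = c j' i.
    have := ezz i; rewrite !ffunE /= => /(congr1 (divn^~ N.+1)).
    by rewrite !divnMDl // !divn_small ?ltn_ord // !addn0.
  congr pair; first by apply: c_inj; apply: eq_bigr => i _; rewrite e1.
  apply/ffunP => i; apply/val_inj.
  by have := ezz i; rewrite !ffunE /= e1 => /addnI.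
have tau_inj : injective tau.
  move=> [j r] [j' r'] [/sigma_inj-> /ffunP err]; congr pair.
  by apply/ffunP => i; have := err i; rewrite !ffunE => /rev_ord_inj.
have LT t : L t + L (tau t) = T.
  rewrite /T /D /L -(cE t.1) -!big_split /= !big_distrr -!big_split /=.
  apply: eq_bigr => i _; rewrite !ffunE /=.
  have : t.2 i <= N by rewrite -ltnS.
  set r := nat_of_ord (t.2 i); set x := c _ _; set y := c _ _ => rN.
  rewrite subSS -mulnDl.
  have -> : x * N.+1 + r + (y * N.+1 + (N - r)) = N.+1 * (x + y) + N by lia.
  by rewrite mulnDl -mulnA (mulnDl x).
have half := half_card I L tau T tau_inj LT.
set A := [pred i | L i <= T %/ 2] in half.
have uZ : uniq (map z (enum A)) by rewrite map_inj_uniq // enum_uniq.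
have := @simplex_points n d (T %/ 2) _ d_gt0 uZ.
rewrite size_map -cardE -/D -/P => count.
have {}count : #|A| * (n`! * P) <= (T %/ 2 + D) ^ n.
  by apply: count => _ /mapP[t + ->]; rewrite mem_enum inE.
have cI : #|{: I}| = m * N.+1 ^ n by rewrite card_prod card_ffun !card_ord.
rewrite cI in half.
apply: leq_trans (_ : 2 ^ n * (2 * #|A| * (n`! * P)) <= _).
  have := leq_mul (leqnn (2 ^ n)) (leq_mul half (leqnn (n`! * P))).
  by congr (_ <= _); lia.
rewrite -mulnA mulnCA leq_mul2l /=.
apply: leq_trans (leq_mul (leqnn (2 ^ n)) count) _.
have le_base : 2 * (T %/ 2 + D) <= N.+1 * (E + D) + 2 * D.
  by have := leq_trunc_div T 2; rewrite /T; nia.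
by rewrite -expnMn; case: (n) => // k; rewrite leq_exp2r.
Qed.

End Counting.

(** * Symmetric semigroups and their Apery sets *)

Lemma int_memE (S : set nat) (n : nat) : int_mem S n%:Z <-> S n.
Proof.
split=> [[m Sm /eqP]|Sn]; last by exists n.
by rewrite eqz_nat => /eqP ->.
Qed.

Lemma semigroup_of0 (s : seq nat) : semigroup_of s 0%N.
Proof. by exists (fun=> 0%N); rewrite big1. Qed.

Lemma semigroup_ofD (s : seq nat) (x y : nat) :
  semigroup_of s x -> semigroup_of s y -> semigroup_of s (x + y)%N.
Proof.
move=> [c ->] [e ->]; exists (fun z => c z + e z)%N.
by rewrite -big_split; apply: eq_bigr => z _; rewrite mulnDl.
Qed.

Lemma semigroup_ofM (s : seq nat) (k x : nat) :
  semigroup_of s x -> semigroup_of s (k * x)%N.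
Proof.
move=> Sx; elim: k => [|k IH]; first exact: semigroup_of0.
by rewrite mulSn; apply: semigroup_ofD.
Qed.

(** Repetitions must be excluded: the coefficient depends only on the value of
    the generator, so that the list 2, 2 generates the multiples of 4. *)
Lemma semigroup_of_gen (s : seq nat) (x : nat) :
  uniq s -> x \in s -> semigroup_of s x.
Proof.
move=> us xs; exists (fun y => (y == x)%N : nat).
rewrite (bigD1_seq x) //= eqxx mul1n big1 ?addn0 // => y /negPf ->.
by rewrite mul0n.
Qed.

Lemma frobeniusE (S : set nat) (F : int) : is_frobenius S F -> frobenius S = F.
Proof.
move=> SF; have [nF gtF] : is_frobenius S (frobenius S).
  exact: (xgetPex 0 (ex_intro _ F SF)).
case: SF => nF' gtF'.
by case: (ltgtP (frobenius S) F) => // [/gtF|/gtF'].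
Qed.

(** Symmetry at n = 0 excludes F(S) from S, and for n > F(S) the number F(S) - n
    is negative, so n lies in S.  In particular the complement of S is finite,
    and F(S) is not the default value in the definition of [frobenius]. *)
Lemma symmetric_is_frobenius (S : set nat) :
  S 0%N -> symmetric_semigroup S -> is_frobenius S (frobenius S).
Proof.
move=> S0 symS; split.
  case: (symS 0) => -[h0 h1]; first by rewrite subr0 in h1.
  by case: h0; apply/int_memE.
move=> z Fz; case: (symS z) => -[] // _ [n _ en]; lia.
Qed.

(** The least element of S in the class of j modulo m. *)
Lemma apery_element (S : set nat) (m : nat) (F : int) :
  (0 < m)%N -> is_frobenius S F ->
  forall j : 'I_m, exists w : nat,
    [/\ S w, (w %% m)%N = j & ~ int_mem S (w%:Z - m%:Z)].
Proof.
move=> m_gt0 [_ gtF] j.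
have exw : exists w, `[< S w >] && (w %% m == j)%N.
  exists (`|F|.+1 * m + j)%N; apply/andP; split.
    by apply/asboolP/int_memE/gtF; nia.
  by rewrite modnMDl modn_small.
case: (ex_minnP exw) => w /andP[/asboolP Sw /eqP wj] minw.
exists w; split=> // -[n Sn en].
have ew : w = (n + m)%N by lia.
have : (w <= n)%N.
  by apply: minw; apply/andP; split; [apply/asboolP|rewrite -wj ew modnDr].
lia.
Qed.

(** If v < w then w - m would be v plus a multiple of m. *)
Lemma apery_unique (S : set nat) (m v w : nat) :
  S m -> (forall x y, S x -> S y -> S (x + y)%N) -> S 0%N ->
  S v -> ~ int_mem S (v%:Z - m%:Z) -> S w -> ~ int_mem S (w%:Z - m%:Z) ->
  v = w %[mod m] -> v = w.
Proof.
move=> Sm SD S0; wlog : v w / (v <= w)%N => [wlog_le|].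
  by case: (leqP v w) => [/wlog_le//|/ltnW/wlog_le h *]; apply/esym/h.
rewrite leq_eqVlt => /predU1P[//|v_lt_w] Sv _ Sw nSw vw.
case: nSw.
have [k ek] : exists k, (w - v = k * m)%N.
  by apply/dvdnP; rewrite -eqn_mod_dvd ?(ltnW v_lt_w) //; apply/eqP.
have [k' ek'] : exists k', k = k'.+1 by case: k ek => [|k' _]; [lia|exists k'].
exists (v + k' * m)%N; last by nia.
apply: (SD _ _ Sv) => //; elim: k' {ek'} => [|l Sl]; first exact: S0.
by rewrite mulSn; apply: SD.
Qed.

(** The Apery elements [w j], written as values of the linear form of [s] at
    points [c j], satisfy the hypotheses of [symmetric_staircase] with
    E = F + m. *)
Lemma symmetric_semigroup_bound (m : nat) (s : seq nat) :
  uniq (m :: s) -> all (leq 1) (m :: s) ->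
  symmetric_semigroup (semigroup_of (m :: s)) ->
  exists2 g : nat,
    g%:Z = frobenius (semigroup_of (m :: s)) + (\sum_(x <- m :: s) x)%N%:Z &
    (2 ^ size s * (size s)`! * \prod_(x <- m :: s) x <= 2 * g ^ size s)%N.
Proof.
set S := semigroup_of _; set F := frobenius S => us s_gt0 symS.
have [m_gt0 /allP s'_gt0] := andP s_gt0.
have S0 : S 0%N by exact: semigroup_of0.
have SD x y : S x -> S y -> S (x + y)%N by exact: semigroup_ofD.
have Sm : S m by apply: semigroup_of_gen => //; exact: mem_head.
have frobF := symmetric_is_frobenius S S0 symS.
have /fin_all_exists[w Hw] := apery_element S m F m_gt0 frobF.
(* If w is an Apery element then so is u = F + m - w: by symmetry u is in S
   because w - m is not, and u - m = F - w is not in S because w is. *)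
have /fin_all_exists[sigma Hsigma] (j : 'I_m) :
    exists j' : 'I_m, (w j)%:Z + (w j')%:Z = F + m%:Z.
  have [Sw wj nSw] := Hw j.
  have [u Su eu] : int_mem S (F - ((w j)%:Z - m%:Z)).
    by case: (symS ((w j)%:Z - m%:Z)) => -[].
  have nSu : ~ int_mem S (u%:Z - m%:Z).
    case: (symS (w j)%:Z) => -[h1 h2]; last by case: h1; apply/int_memE.
    by have -> : u%:Z - m%:Z = F - (w j)%:Z by lia.
  have u_lt : (u %% m < m)%N by rewrite ltn_mod.
  exists (Ordinal u_lt); have [Sw' wj' nSw'] := Hw (Ordinal u_lt).
  have -> : w (Ordinal u_lt) = u by apply: (apery_unique S m).
  lia.
have w_inj : injective w.
  move=> i j ewij; apply/val_inj.
  have [_ wi _] := Hw i; have [_ wj _] := Hw j.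
  by rewrite -[LHS]wi -[RHS]wj ewij.
have sigma_inj : injective sigma.
  move=> i j eij; apply: w_inj.
  by have := Hsigma i; have := Hsigma j; rewrite eij; lia.
have /fin_all_exists[c Hc] (j : 'I_m) : exists c : 'I_(size s) -> nat,
    w j = (\sum_i c i * nth 0 s i)%N.
  have [[c ec] _ nSw] := Hw j; exists (fun i => c (nth 0%N s i)).
  rewrite big_cons (big_nth 0%N) big_mkord in ec.
  case: (c m) ec => [|k] ec; first by rewrite ec mul0n add0n.
  (* A positive coefficient of m would leave w j - m in S. *)
  case: nSw; exists (k * m + \sum_(i < size s) c (nth 0 s i) * nth 0 s i)%N.
    apply: SD; first exact: semigroup_ofM.
    have us' : uniq s by case/andP: us.
    exists (fun x => if x == m then 0%N else c x).
    rewrite big_cons eqxx mul0n add0n (big_nth 0%N) big_mkord.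
    apply: eq_bigr => i _; case: eqP => // e.
    by case/andP: us; rewrite -e mem_nth.
  by rewrite ec; lia.
have [E eE] : exists E : nat, E%:Z = F + m%:Z.
  by exists (w (Ordinal m_gt0) + w (sigma (Ordinal m_gt0)))%N; rewrite PoszD.
set D := (\sum_(i < size s) nth 0 s i)%N.
exists (E + D)%N.
  by rewrite big_cons (big_nth 0%N) big_mkord -/D; lia.
rewrite big_cons [(\prod_(x <- s) x)%N](big_nth 0%N) big_mkord.
apply: (@symmetric_staircase _ m E (fun i => nth 0%N s i) c sigma) => //.
- by move=> i; apply: s'_gt0; apply: mem_nth.
- by move=> i j; rewrite -!Hc; apply: w_inj.
- by move=> j; rewrite -!Hc; have := Hsigma j; lia.
Qed.

(** * Gluing *)

(** Modulo a, the element d is invertible.  An integer z is therefore a t + e d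
    with 0 <= e < a, and t > F as soon as z exceeds a F + (a - 1) d.  Conversely
    a F + (a - 1) d = a t + e d forces e = a - 1 modulo a, hence F = t + k d
    with k >= 0, which would put F in the semigroup. *)
Lemma gluing_frobenius (q : seq nat) (a d : nat) (F : int) :
  uniq q -> (1 < a)%N -> coprime a d -> semigroup_of q d ->
  is_frobenius (semigroup_of q) F ->
  is_frobenius (semigroup_of (rcons [seq (a * x)%N | x <- q] d))
    (a%:Z * F + (a%:Z - 1) * d%:Z).
Proof.
move=> uq a_gt1 cop Sd [nF gtF]; have a_gt0 : (0 < a)%N by exact: ltnW.
have memW n : semigroup_of (rcons [seq (a * x)%N | x <- q] d) n <->
    exists2 t, semigroup_of q t & exists e, n = (a * t + e * d)%N.
  split=> [[c ->]|[_ [c ->] [e ->]]].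
    rewrite big_rcons big_map /=.
    exists (\sum_(x <- q) c (a * x) * x)%N; first by exists (fun x => c (a * x)%N).
    exists (c d); rewrite big_distrr; congr (_ + _)%N.
    by apply: eq_bigr => x _; rewrite mulnCA.
  (* The generator d differs from every a x, since a > 1 is prime to d. *)
  exists (fun y => if y == d then e else c (y %/ a)%N).
  rewrite big_rcons big_map /= eqxx big_distrr; congr (_ + _)%N.
  apply: eq_bigr => x _; case: eqP => [axd|_]; last by rewrite mulKn // mulnCA.
  by move: cop; rewrite -axd coprimeMr /coprime gcdnn; case: eqP a_gt1 => // ->.
split.
  case=> n /memW[t St [e ->]] eF.
  have : (a%:Z %| (e%:Z + 1) * d%:Z)%Z.
    by apply/dvdzP; exists (F + d%:Z - t%:Z); lia.
  rewrite -(_ : e.+1%:Z = e%:Z + 1); last by lia.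
  rewrite -PoszM dvdzE /= Gauss_dvdl // => /dvdnP[[//|k] ek].
  apply: nF; exists (t + k * d)%N.
    by apply: semigroup_ofD => //; exact: semigroup_ofM.
  have a_neq0 : a%:Z != 0 by lia.
  apply: (mulfI a_neq0); nia.
move=> z ltz.
have [e e_lt ez] : exists2 e : nat, (e < a)%N & (a%:Z %| z - e%:Z * d%:Z)%Z.
  have [u [v]] := Bezoutz a d; rewrite /gcdz !absz_nat (eqP cop) => uv'.
  have uv : u * a%:Z + v * d%:Z = 1 := uv'.
  have a_pos : 0 < a%:Z by lia.
  have r_ge0 : (0 <= (z * v) %% a)%Z by apply: modz_ge0; rewrite gt_eqF.
  have r_lt : ((z * v) %% a < a)%Z by apply: ltz_pmod.
  have /esym/(canRL (addKr _)) er := divz_eq (z * v) a.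
  exists `|((z * v) %% a)%Z|%N; first by lia.
  apply/dvdzP; exists (z * u + ((z * v) %/ a)%Z * d%:Z).
  by rewrite gez0_abs // er -{1}[z]mulr1 -uv; ring.
have /dvdzP[t et] := ez.
have [n Sn en] : int_mem (semigroup_of q) t by apply: gtF; nia.
exists (a * n + e * d)%N; last by nia.
by apply/memW; exists n => //; exists e.
Qed.

(** * The bound for the glued semigroup *)

Theorem lemma3 (R : realType) (k : fieldType) (q : 5.-tuple nat)
    (beta a d6 : nat)
    (q_num : numerical_generators q)
    (q_min : minimal_generators q)
    (q_sym : symmetric_semigroup (semigroup_of q))
    (q_nci : ~ complete_intersection k q)
    (q_beta : is_betti1 k q beta)
    (a_gt1 : (1 < a)%N)
    (d6_in : semigroup_of q d6)
    (d6_notin : d6 \notin q)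
    (a_d6 : gcdn a d6 = 1%N) :
  let W6 := semigroup_of (rcons [seq (a * x)%N | x <- q] d6) in
  let pi5 : R := \prod_(j < 5) (tnth q j)%:R in
  let lambda5 : R := (192 * (beta%:R - 1) / beta%:R) `^ (1 / 4) in
  let g6w : R := a%:R * (lambda5 * pi5 `^ (1 / 4) + d6%:R) in
  let F6w : R := g6w - (a%:R * (\sum_(j < 5) (tnth q j)%:R) + d6%:R) in
  F6w <= (frobenius W6)%:~R.
Proof.
lazy zeta; set W6 := semigroup_of (rcons _ _); set pi5 := \prod_(j < 5) _.
set lambda5 := _ `^ _.
have [uq _] := q_min; have [q_gt0 _] := q_num.
set F := frobenius (semigroup_of q).
have frobF : is_frobenius (semigroup_of q) F.
  by apply: symmetric_is_frobenius => //; exact: semigroup_of0.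
have /frobeniusE FW : is_frobenius W6 (a%:Z * F + (a%:Z - 1) * d6%:Z).
  by apply: gluing_frobenius => //; apply/eqP.
have [g eg g_ge] : exists2 g : nat, g%:Z = F + (\sum_(x <- q) x)%N%:Z &
    (192 * \prod_(x <- q) x <= g ^ 4)%N.
  (* With n = 4 the general bound reads 2 ^ 4 * 4! * prod <= 2 * g ^ 4. *)
  have : exists2 g : nat, g%:Z = F + (\sum_(x <- q) x)%N%:Z &
    (2 ^ (size q).-1 * (size q).-1`! * \prod_(x <- q) x
       <= 2 * g ^ (size q).-1)%N.
    have : size q != 0%N by rewrite size_tuple.
    rewrite /F; case: (tval q) uq q_gt0 q_sym => // m s us s_gt0 symS _.
    exact: symmetric_semigroup_bound.
  rewrite size_tuple => -[g eg le_g]; exists g => //=.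
  move: le_g; rewrite /= (_ : 2 ^ 4 * 4`! = 2 * 192)%N //.
  by rewrite -mulnA leq_pmul2l.
have pi5E : pi5 = (\prod_(x <- q) x)%N%:R.
  by rewrite big_tuple natr_prod.
have sumE : \sum_(j < 5) (tnth q j)%:R = (\sum_(x <- q) x)%N%:R :> R.
  by rewrite big_tuple natr_sum.
have pi5_ge0 : 0 <= pi5 by rewrite pi5E.
have lam_ge0 : 0 <= 192 * (beta%:R - 1) / beta%:R :> R.
  (* At beta = 0 the quotient is 0, the inverse of 0 being 0. *)
  case: beta {q_beta lambda5} => [|b]; first by rewrite invr0 mulr0.
  have -> : b.+1%:R - 1 = b%:R :> R by rewrite -natr1 addrK.
  by rewrite divr_ge0 // mulr_ge0.
have lam_le : 192 * (beta%:R - 1) / beta%:R <= 192 :> R.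
  case: beta {q_beta lambda5 lam_ge0} => [|b]; first by rewrite invr0 mulr0.
  by rewrite ler_pdivrMr ?ltr0Sn // ler_pM2l ?ltr0n // gerDl lerN10.
have main : lambda5 * pi5 `^ (1 / 4) <= g%:R.
  have -> : g%:R = (g%:R ^+ 4) `^ (1 / 4) :> R.
    by rewrite -powR_mulrn // -powRrM mul1r mulfV ?pnatr_eq0 // powRr1.
  rewrite -powRM // ge0_ler_powR ?nnegrE //; [|exact: mulr_ge0|exact: exprn_ge0|].
    by rewrite mul1r invr_ge0.
  apply: le_trans (_ : 192 * pi5 <= _); first by rewrite ler_wpM2r.
  by rewrite pi5E -natrX -natrM ler_nat.
rewrite FW sumE.
have -> : F = g%:Z - (\sum_(x <- q) x)%N%:Z by rewrite eg addrK.
rewrite rmorphD !rmorphM !rmorphB /= -!pmulrn.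
have a_ge0 : 0 <= a%:R :> R by [].
have := ler_wpM2l a_ge0 main.
set A := (a%:R : R); set B := (\sum_(x <- q) x)%N%:R.
set C := (d6%:R : R); set X := _ * _ `^ _.
by move=> h; lra.
Qed.
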